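(* Let $X$, $A$, $T(t,s)$, $\mu$, $\nu$, $P^1,P^2,P^3$, $D,\lambda,d$, $f$ and $c$ satisfy all the assumptions listed in the context. Assume that $P^3(t)=0$ for each $t\ge0$ and that $$c(2D+1)+2cD\lambda^{-1}<1.$$ Then there exists $C>0$ with the following property: for any $\delta>0$ and any differentiable map $y\colon[0,+\infty)\to X$ satisfying $$|y'(t)-A(t)y(t)-f(t,y(t))|\le \frac{\delta\,\mu'(t)}{\mu(t)\,\nu(t)^d}\quad\text{for all } t\ge 0,$$ there exists a solution $x\colon[0,+\infty)\to X$ of $x'=A(t)x+f(t,x)$, $t\ge0$, such that $$\sup_{t\ge 0}|x(t)-y(t)|\le C\delta.$$
   Context: $X=(X,|\cdot|)$ is an arbitrary Banach space, $\mathcal B(X)$ is the space of bounded linear operators on $X$ with operator norm $\|\cdot\|$, and $\mathbb I$ is the identity operator. $A\colon[0,+\infty)\to\mathcal B(X)$ is continuous, and $T(t,s)$, $t,s\ge 0$, denotes the evolution family of $x'=A(t)x$: for fixed $s\ge0$ and $v\in X$, $t\mapsto T(t,s)v$ is the solution of $x'=A(t)x$ on $[0,+\infty)$ with $x(s)=v$ (so $T(t,t)=\mathbb I$ and $T(t,s)T(s,r)=T(t,r)$ for all $t,s,r\ge 0$). $f\colon[0,+\infty)\times X\to X$ is continuous. $\mu\colon[0,+\infty)\to\mathbb R$ is strictly increasing and differentiable with $\mu(0)=1$ and $\lim_{t\to+\infty}\mu(t)=+\infty$. $\nu\colon[0,+\infty)\to[1,+\infty)$ is an arbitrary map. Assumptions: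 (1) there are three families of projections $P^i(t)$, $t\ge0$, $i\in\{1,2,3\}$, on $X$ with $P^1(t)+P^2(t)+P^3(t)=\mathbb I$ for $t\ge 0$; (2) $P^i(t)P^j(t)=0$ for $i\ne j$ and $t\ge 0$; (3) $T(t,s)P^i(s)=P^i(t)T(t,s)$ for all $t,s\ge 0$ and $i\in\{1,2,3\}$; (4) there exist $D,\lambda>0$ and $d\ge 0$ such that $$\|T(t,s)P^1(s)\|\le D\Big(\frac{\mu(t)}{\mu(s)}\Big)^{-\lambda}\nu(s)^d\ \text{ for } t\ge s,\qquad \|T(t,s)P^2(s)\|\le D\Big(\frac{\mu(s)}{\mu(t)}\Big)^{-\lambda}\nu(s)^d\ \text{ for } t\le s;$$ (5) there exists $c\ge 0$ such that $$|f(t,x)-f(t,y)|\le\frac{c\,\mu'(t)}{\mu(t)\nu(t)^d}|x-y|\quad\text{for } t\ge 0 \text{ and } x,y\in X.$$ *)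

(* Defs.v *)
From mathcomp Require Export all_boot all_order all_algebra.
From mathcomp Require Export all_classical all_reals all_analysis.

Set Implicit Arguments.
Unset Strict Implicit.
Unset Printing Implicit Defensive.

Export Order.TTheory GRing.Theory Num.Theory.
Export numFieldNormedType.Exports.

Local Open Scope classical_set_scope.
Local Open Scope ring_scope.

(* Functions on [0, +oo[ are total functions on R that are constrained at
   nonnegative arguments only; hence the one-sided notions at 0 below. *)

Definition nonneg {R : realType} : set R := [set t | 0 <= t].

(* f'(t) = l, for f regarded as a function on [0, +oo[ (so this is the right
   derivative when t = 0). *)
Definition has_deriv {R : realType} {V : normedModType R}
    (f : R -> V) (t : R) (l : V) : Prop :=
  (s - t)^-1 *: (f s - f t) @[s --> within nonneg t^'] --> l.

(* Extended-real valued, so that it is +oo on unbounded linear maps. *)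
Definition opnorm {R : realType} {V : normedModType R} (L : V -> V) : \bar R :=
  ereal_sup [set `|L v|%:E | v in [set v : V | `|v| <= 1]].

Definition opnorm_continuous {R : realType} {V : normedModType R}
    (A : R -> V -> V) : Prop :=
  forall t : R, 0 <= t ->
    opnorm (A s \- A t) @[s --> within nonneg (nbhs t)] --> 0%E.

(* The bounded linear idempotents. *)
Definition is_projection {R : realType} {V : normedModType R}
    (P : {linear V -> V}) : Prop :=
  continuous P /\ forall v : V, P (P v) = P v.

(* T t s v is the value at time t of the solution of x' = A(t) x, x(s) = v.
   That each T t s is a bounded linear operator and the cocycle identity follow
   from uniqueness of solutions and are not required here. *)
Definition is_evolution_family {R : realType} {V : normedModType R}
    (A : R -> V -> V) (T : R -> R -> V -> V) : Prop :=
  forall (s : R) (v : V), 0 <= s ->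
    T s s v = v /\
    forall t : R, 0 <= t -> has_deriv (fun r => T r s v) t (A t (T t s v)).

Definition is_solution {R : realType} {V : normedModType R}
    (A : R -> V -> V) (f : R -> V -> V) (x : R -> V) : Prop :=
  forall t : R, 0 <= t -> has_deriv x t (A t (x t) + f t (x t)).

(* Main.v *)
Require Import Defs.
From mathcomp Require Import ring lra.

(** Picard iteration [x_0 = y], [x_{n+1}' = A x_{n+1} + f(t, x_n)], where each
    [x_{n+1}] is the solution staying within [2 D / lambda * K_n] of [x_n], if
    [K_n mu' / (mu nu^d)] bounds the residual of [x_n]; the Lipschitz condition
    makes [K_n] geometric of ratio [2 c D / lambda < 1].

    The residual need not be continuous ([mu'] and [y'] are arbitrary
    derivatives, [nu] is arbitrary), so no vector-valued integral of it is used.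
    Pulling back to time 0, [T(0,s) y(s) - G(s)], with [G] an antiderivative of
    the continuous map [T(0,s) F(s)], is an antiderivative of the pulled-back
    residual, and the dichotomy estimates follow from the mean value inequality
    with the comparison functions [mu^lambda] and [mu^-lambda]. *)

(** * Interval induction and limits of sequences *)

Local Open Scope classical_set_scope.
Local Open Scope ring_scope.

(* Cousin's lemma: any gauge on [a, b] admits a fine tagged partition. *)
Lemma tagged_interval_induction {R : realType} (P : R -> R -> Prop) (a b : R) :
    a <= b ->
    (forall u v w, a <= u -> u <= v -> v <= w -> w <= b ->
      P u v -> P v w -> P u w) ->
    (forall t, a <= t -> t <= b -> exists2 r, 0 < r &
      forall u v, a <= u -> u <= t -> t <= v -> v <= b -> v - u < r -> P u v) ->
  P a b.
Proof.
move=> ab Ptrans Ploc.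
pose S := [set t | [/\ a <= t, t <= b & P a t]].
have Sa : S a.
  split=> //; have [r r0 Pr] := Ploc a (lexx _) ab.
  by apply: Pr; rewrite ?subrr.
have ubS : ubound S b by move=> t [].
have hS : has_sup S by split; [exists a | exists b].
pose m := sup S.
have am : a <= m by apply: ub_le_sup => //; exists b.
have mb : m <= b by apply: ge_sup => //; exists a.
have [r r0 Pr] := Ploc m am mb.
have [t [at_ tb Pat] mt] := sup_adherent r0 hS.
have tm : t <= m by apply: ub_le_sup => //; exists b.
have ext w : m <= w -> w <= b -> w - t < r -> P a w.
  move=> mw wb wr; apply: (Ptrans _ t) => //; first exact: le_trans mw.
  exact: Pr.
have [mb'|bm] := ltP m b; last first.
  have mE : m = b by apply/eqP; rewrite eq_le mb bm.
  by apply: ext; rewrite -?mE // ltrBlDr -ltrBlDl -/m; rewrite /m; lra.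
(* Since [m - t < r], the point [t + (m - t + r) / 2] lies beyond [m] and still within [r] of
   [t]. *)
pose w := Num.min b (t + (m - t + r) / 2).
have mw : m <= w.
  rewrite /w le_min mb /=; move: mt; rewrite -/m; lra.
have mltw : m < w.
  rewrite /w lt_min mb' /=; move: mt; rewrite -/m; lra.
have wb : w <= b by rewrite /w ge_min lexx.
have wr : w - t < r.
  have : w <= t + (m - t + r) / 2 by rewrite /w ge_min lexx orbT.
  by move: mt; rewrite -/m; lra.
have Sw : S w by split=> //; [exact: le_trans mw | exact: ext].
have : w <= m by apply: ub_le_sup => //; exists b.
by rewrite leNgt mltw.
Qed.

(** The bound on pairs passes to the limit in [m], so the limit comes with its rate. The threshold
    [N] serves the antiderivative, whose approximations are controlled at a given point only from
    some index on. *)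
Lemma cauchy_bound_lim {R : realType} {V : completeNormedModType R}
    (u : nat -> V) (e : nat -> R) (N : nat) :
    e n @[n --> \oo] --> 0 ->
    (forall n m, (N <= n)%N -> (n <= m)%N -> `|u n - u m| <= e n) ->
  exists l, forall n, (N <= n)%N -> `|u n - l| <= e n.
Proof.
move=> e0 ue.
have cu : cvgn u.
  apply/cauchy_cvgP/cauchy_exP => r r0.
  have /cvgrPdist_lt/(_ r r0) [M _ HM] := e0.
  exists (u (maxn N M)); exists (maxn N M) => // m /= Mm.
  rewrite -ball_normE /=; apply: le_lt_trans (ue _ _ _ Mm) _.
    exact: leq_maxl.
  have := HM (maxn N M) (leq_maxr _ _); rewrite /= sub0r normrN.
  exact/le_lt_trans/ler_norm.
exists (limn u) => n Nn.
have cnu : `|u n - u m| @[m --> \oo] --> `|u n - limn u|.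
  by apply: cvg_norm; apply: cvgB => //; exact: cvg_cst.
apply: (@closed_cvg _ _ _ eventually_filter _ (fun x : R => x <= e n) _ _ _
  cnu).
  exact: closed_le.
by exists n => // m /= nm; exact: ue.
Qed.

(** * Derivatives on the half-line *)

Section derivative.
Context {R : realType} {V : normedModType R}.
Implicit Types (f g u : R -> V) (L : V -> V) (t : R) (l v : V).

Definition cont_on_nonneg f := forall t, 0 <= t -> forall e : R, 0 < e ->
  exists2 r, 0 < r & forall s : R, 0 <= s -> `|s - t| < r -> `|f s - f t| <= e.

Lemma has_derivP f t l : has_deriv f t l <->
  forall e : R, 0 < e -> exists2 r, 0 < r & forall s : R, 0 <= s ->
    `|s - t| < r -> `|f s - f t - (s - t) *: l| <= e * `|s - t|.
Proof.
split=> [/cvgrPdist_le fl e e0|H].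
  have := fl e e0; rewrite /within /= => -[r /= r0 Hr].
  exists r => // s s0 sr; have [->|st] := eqVneq s t.
    by rewrite !subrr scale0r subrr !normr0 mulr0.
  have st0 : s - t != 0 by rewrite subr_eq0.
  have := Hr s; rewrite /= distrC => /(_ sr st s0).
  have st0' : 0 < `|s - t| by rewrite normr_gt0.
  rewrite -(ler_pM2r st0') => H; apply: le_trans H.
  rewrite mulrC -normrZ scalerBr scalerA mulfV// scale1r distrC.
  by rewrite lexx.
apply/cvgrPdist_le => e e0; have [r r0 Hr] := H e e0.
exists r => //= s /=; rewrite distrC => sr st s0.
have st0 : s - t != 0 by rewrite subr_eq0.
have := Hr s s0 sr; rewrite -ler_pdivrMr ?normr_gt0//; apply: le_trans.
rewrite mulrC -normfV -normrZ (scalerBr _ (f s - f t)) scalerA mulVf// scale1r.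
by rewrite distrC.
Qed.

Lemma linear_subE {L} : linear L -> forall v w, L (v - w) = L v - L w.
Proof. by move=> lL v w; rewrite addrC -scaleN1r lL scaleN1r addrC. Qed.

Lemma linear_0E {L} : linear L -> L 0 = 0.
Proof. by move=> lL; rewrite -{1}(subrr 0) linear_subE ?subrr. Qed.

Lemma linear_addE {L} : linear L -> forall v w, L (v + w) = L v + L w.
Proof. by move=> lL v w; rewrite -[v]scale1r lL !scale1r. Qed.

Lemma linear_scaleE {L} : linear L -> forall a v, L (a *: v) = a *: L v.
Proof. by move=> lL a v; rewrite -[a *: v]addr0 lL linear_0E ?addr0. Qed.

(** The remainders at [u] and [v] subtract, and [u <= t <= v] makes the two distances to [t] add up
    to [v - u]: this is the form that a tagged partition consumes. *)
Lemma has_deriv_straddle {f t l} : has_deriv f t l ->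
  forall e : R, 0 < e -> exists2 r, 0 < r & forall u v : R,
    0 <= u -> u <= t -> t <= v -> v - u < r ->
    `|f v - f u - (v - u) *: l| <= e * (v - u).
Proof.
move=> /has_derivP fl e e0; have [r r0 Hr] := fl e e0.
exists r => // u v u0 ut tv uvr.
have -> : f v - f u - (v - u) *: l =
    (f v - f t - (v - t) *: l) - (f u - f t - (u - t) *: l).
  have -> : v - u = (v - t) - (u - t) by ring.
  rewrite [X in _ - X = _]scalerBl (opprD (_ *: l)) (opprD (f u - f t)) !opprK.
  by rewrite [RHS]addrACA opprB subrKA.
apply: le_trans (ler_normB _ _) _.
have v0 : 0 <= v by lra.
have nv : `|v - t| = v - t by rewrite ger0_norm ?subr_ge0.
have nu : `|u - t| = t - u by rewrite distrC ger0_norm ?subr_ge0.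
apply: le_trans (lerD (Hr v v0 _) (Hr u u0 _)) _; rewrite ?nv ?nu; nra.
Qed.

Lemma has_deriv_cvg {f t l} : has_deriv f t l ->
  forall e : R, 0 < e -> exists2 r, 0 < r & forall s : R, 0 <= s ->
    `|s - t| < r -> `|f s - f t| <= e.
Proof.
move=> /has_derivP fl e e0; have [r r0 Hr] := fl 1 ltr01.
have l0 : 0 < 1 + `|l| by rewrite ltr_pwDl.
exists (Num.min r (e / (1 + `|l|))); first by rewrite lt_min r0 divr_gt0.
move=> s s0; rewrite lt_min => /andP[sr se].
rewrite -[f s - f t](subrK ((s - t) *: l)).
apply: le_trans (ler_normD _ _) _.
apply: le_trans (lerD (Hr s s0 sr) (lexx _)) _.
by rewrite normrZ mul1r -{1}[`|s - t|]mulr1 -mulrDr -ler_pdivlMr// ltW.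
Qed.

Lemma has_deriv_cont f df : (forall t, 0 <= t -> has_deriv f t (df t)) ->
  cont_on_nonneg f.
Proof. by move=> fd t t0; exact: has_deriv_cvg (fd t t0). Qed.

Lemma has_deriv_cst v t : has_deriv (fun=> v) t 0.
Proof.
apply/has_derivP => e e0; exists 1 => // s _ _.
by rewrite scaler0 subr0 subrr normr0 mulr_ge0 // ltW.
Qed.

Lemma has_derivB f g t l m : has_deriv f t l -> has_deriv g t m ->
  has_deriv (fun s => f s - g s) t (l - m).
Proof.
move=> /has_derivP fl /has_derivP gm; apply/has_derivP => e e0.
have e2 : 0 < e / 2 by rewrite divr_gt0.
have [r r0 Hr] := fl _ e2; have [q q0 Hq] := gm _ e2.
exists (Num.min r q); first by rewrite lt_min r0.
move=> s s0; rewrite lt_min => /andP[sr sq].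
have -> : f s - g s - (f t - g t) - (s - t) *: (l - m) =
    (f s - f t - (s - t) *: l) - (g s - g t - (s - t) *: m).
  rewrite (scalerBr _ l) (opprD (_ *: l)) (opprD (g s - g t)) !opprK.
  by rewrite [RHS]addrACA; congr (_ + _); rewrite !opprD !opprK addrACA.
apply: le_trans (ler_normB _ _) _.
apply: le_trans (lerD (Hr s s0 sr) (Hq s s0 sq)) _; lra.
Qed.

(* [S] is only strongly differentiable: local boundedness is what lets
   [S s] act on the remainder of [u]. *)
Lemma has_deriv_app (S : R -> V -> V) u t l du (M r0 : R) : 0 < r0 ->
  (forall s : R, 0 <= s -> linear (S s)) ->
  (forall s : R, 0 <= s -> `|s - t| < r0 -> forall v, `|S s v| <= M * `|v|) ->
  (forall e : R, 0 < e -> exists2 r, 0 < r & forall s : R, 0 <= s ->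
    `|s - t| < r -> `|S s du - S t du| <= e) ->
  has_deriv (S ^~ (u t)) t l -> has_deriv u t du ->
  has_deriv (fun s => S s (u s)) t (l + S t du).
Proof.
move=> r00 linS bS cS /has_derivP Sl /has_derivP udu; apply/has_derivP => e e0.
have e3 : 0 < e / 3 by rewrite divr_gt0.
have M0 : 0 < 1 + `|M| by rewrite ltr_pwDl.
have [r1 r10 H1] := Sl _ e3; have [r2 r20 H2] := cS _ e3.
have [r3 r30 H3] := udu (e / 3 / (1 + `|M|)) (divr_gt0 e3 M0).
exists (Num.min (Num.min r0 r1) (Num.min r2 r3)).
  by rewrite !lt_min r00 r10 r20.
move=> s s0; rewrite !lt_min => /andP[/andP[sr0 sr1] /andP[sr2 sr3]].
have -> : S s (u s) - S t (u t) - (s - t) *: (l + S t du) =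
    S s (u s - u t - (s - t) *: du) + (s - t) *: (S s du - S t du) +
    (S s (u t) - S t (u t) - (s - t) *: l).
  rewrite !(linear_subE (linS s s0)) (linear_scaleE (linS s s0)).
  rewrite (scalerDr _ l) (scalerBr _ (S s du)).
  by rewrite subrKA [RHS]addrAC [X in _ = X - _]addrA subrKA opprD addrA.
apply: le_trans (ler_normD _ _) _.
apply: le_trans (lerD (ler_normD _ _) (H1 s s0 sr1)) _.
have -> : e * `|s - t| =
  e / 3 * `|s - t| + e / 3 * `|s - t| + e / 3 * `|s - t| by field.
apply: lerD => //; apply: lerD; last first.
  by rewrite normrZ mulrC ler_wpM2r// H2.
apply: le_trans (bS s s0 sr0 _) _.
apply: le_trans (_ : (1 + `|M|) * (e / 3 / (1 + `|M|) * `|s - t|) <= _).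
  have HM : M <= 1 + `|M| by apply: le_trans (ler_norm M) _; rewrite lerDr.
  by apply: le_trans (ler_wpM2r (normr_ge0 _) HM) _; rewrite ler_pM2l// H3.
by rewrite mulrA mulrCA mulfV ?gt_eqF// mulr1.
Qed.

Lemma has_deriv_lin L f t l (M : R) : linear L ->
  (forall v, `|L v| <= M * `|v|) -> has_deriv f t l ->
  has_deriv (L \o f) t (L l).
Proof.
move=> linL bL fl; rewrite -[L l]add0r.
apply: (@has_deriv_app (fun=> L) f t 0 l M 1) => //.
  by move=> e e0; exists 1 => // s _ _; rewrite subrr normr0 ltW.
exact: has_deriv_cst.
Qed.

Lemma has_derivZ (a : R) f t l : has_deriv f t l ->
  has_deriv (fun s => a *: f s) t (a *: l).
Proof.
apply: (@has_deriv_lin ( *:%R a) f t l `|a|).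
  by move=> b v w; rewrite scalerDr !scalerA mulrC.
by move=> v; rewrite normrZ.
Qed.

Lemma has_derivD f g t l m : has_deriv f t l -> has_deriv g t m ->
  has_deriv (fun s => f s + g s) t (l + m).
Proof.
move=> fl /(has_derivZ (-1)) /(has_derivB _ _ _ _ _ fl).
rewrite scaleN1r opprK; congr has_deriv; apply/funext => s.
by rewrite scaleN1r opprK.
Qed.

End derivative.

Lemma has_deriv_eq {R : realType} {V : normedModType R} (f g : R -> V)
    (t : R) (l : V) : (forall s, 0 <= s -> f s = g s) -> 0 <= t ->
  has_deriv f t l -> has_deriv g t l.
Proof.
move=> fg t0 /has_derivP H; apply/has_derivP => e e0.
have [r r0 Hr] := H e e0; exists r => // s s0 sr.
by rewrite -!fg//; exact: Hr.
Qed.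

(** * Mean value and Gronwall inequalities *)

(** With slack [d * (v - u)] the inequality is additive over adjacent intervals, and on a short
    interval tagged by [t] it follows from the first-order expansions of [w] and [phi] at [t];
    Cousin's lemma does the rest. *)
Lemma mean_value_le {R : realType} {V : normedModType R} (w dw : R -> V)
    (phi dphi : R -> R) (a b : R) : 0 <= a -> a <= b ->
    (forall t, a <= t -> t <= b -> has_deriv w t (dw t)) ->
    (forall t, a <= t -> t <= b -> has_deriv (phi : R -> R^o) t (dphi t)) ->
    (forall t, a <= t -> t <= b -> `|dw t| <= dphi t) ->
  `|w b - w a| <= phi b - phi a.
Proof.
move=> a0 ab wd pd wp; apply/ler_addgt0Pr => e e0.
pose d := e / (b - a + 1).
have ba0 : 0 < b - a + 1 by lra.
have d0 : 0 < d by rewrite divr_gt0.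
suff H : `|w b - w a| <= phi b - phi a + d * (b - a).
  apply: le_trans H _; rewrite lerD2l /d -mulrA ler_piMr ?(ltW e0)//.
  by rewrite mulrC ler_pdivrMr// mul1r lerDl.
apply: (@tagged_interval_induction _ (fun u v =>
  `|w v - w u| <= phi v - phi u + d * (v - u))) => //.
- move=> s t v _ _ _ _ st tv; rewrite -(subrKA (w t)).
  apply: le_trans (ler_normD _ _) _; lra.
- move=> t at_ tb; have d2 : 0 < d / 2 by rewrite divr_gt0.
  have [r r0 Hr] := has_deriv_straddle (wd t at_ tb) _ d2.
  have [q q0 Hq] := has_deriv_straddle (pd t at_ tb) _ d2.
  exists (Num.min r q); first by rewrite lt_min r0.
  move=> u v au ut tv vb; rewrite lt_min => /andP[uvr uvq].
  have u0 : 0 <= u by lra.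
  have {}Hr := Hr u v u0 ut tv uvr; have {}Hq := Hq u v u0 ut tv uvq.
  rewrite -[w v - w u](subrK ((v - u) *: dw t)).
  apply: le_trans (ler_normD _ _) _.
  rewrite normrZ ger0_norm ?subr_ge0; last lra.
  move: Hq; rewrite ler_norml => /andP[Hq _].
  have : (v - u) * `|dw t| <= (v - u) * dphi t.
    by rewrite ler_wpM2l ?wp// subr_ge0 (le_trans ut).
  move: Hq; rewrite /GRing.scale /=; lra.
Qed.

(** Both inequalities multiply over adjacent intervals, so Cousin's lemma reduces them to short
    ones. Adding [e] to the norms absorbs the first-order error there, at the price of the rate
    [M + 1] in place of [M]. *)
Lemma gronwall_two_sided {R : realType} {V : normedModType R} (z dz : R -> V)
    (M a b : R) : 0 <= a -> a <= b -> 0 <= M ->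
    (forall t, a <= t -> t <= b -> has_deriv z t (dz t)) ->
    (forall t, a <= t -> t <= b -> `|dz t| <= M * `|z t|) ->
  `|z b| <= expR ((M + 1) * (b - a)) * `|z a| /\
  `|z a| <= expR ((M + 1) * (b - a)) * `|z b|.
Proof.
move=> a0 ab M0 zd zM; set K := M + 1; set E := expR _.
have E0 : 0 < E by exact: expR_gt0.
suff H e : 0 < e ->
    `|z b| + e <= E * (`|z a| + e) /\ `|z a| + e <= E * (`|z b| + e).
  have eE e : 0 < e -> E * (e / E) = e by move=> _; field; rewrite gt_eqF.
  split; apply/ler_addgt0Pr => e e0; have eE0 : 0 < e / E by rewrite divr_gt0.
  - by have [+ _] := H _ eE0; rewrite mulrDr eE //; lra.
  - by have [_ +] := H _ eE0; rewrite mulrDr eE //; lra.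
move=> e0; apply: (@tagged_interval_induction _ (fun u v =>
  `|z v| + e <= expR (K * (v - u)) * (`|z u| + e) /\
  `|z u| + e <= expR (K * (v - u)) * (`|z v| + e))) => //.
- move=> u v w _ _ _ _ [H1 H2] [H3 H4].
  have -> : K * (w - u) = K * (w - v) + K * (v - u) by ring.
  rewrite expRD; split.
    by apply: le_trans H3 _; rewrite -mulrA ler_pM2l ?expR_gt0.
  apply: le_trans H2 _.
  by rewrite [in leRHS](mulrC (expR _)) -mulrA ler_pM2l ?expR_gt0.
- move=> t at_ tb.
  have [r r0 Hr] := has_deriv_straddle (zd t at_ tb) _ e0.
  have [q q0 Hq] := has_deriv_cvg (zd t at_ tb) _ e0.
  exists (Num.min r q); first by rewrite lt_min r0.
  move=> u v au ut tv vb; rewrite lt_min => /andP[uvr uvq].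
  have u0 : 0 <= u by lra.
  have v0 : 0 <= v by lra.
  have uv : 0 <= v - u by lra.
  have {}Hr := Hr u v u0 ut tv uvr.
  have Hu : `|z u - z t| <= e by apply: Hq => //; rewrite distrC ger0_norm; lra.
  have Hv : `|z v - z t| <= e by apply: Hq => //; rewrite ger0_norm; lra.
  have zt := zM t at_ tb.
  have diff : `|z v - z u| <= (v - u) * (M * `|z t| + e).
    rewrite -[z v - z u](subrK ((v - u) *: dz t)).
    apply: le_trans (ler_normD _ _) _; rewrite normrZ (ger0_norm uv).
    by apply: le_trans (lerD Hr (ler_wpM2l uv zt)) _; lra.
  (* The norm of the increment is symmetric in [u] and [v], so one estimate yields both
     directions. *)
  have step s s' : `|z s - z t| <= e -> `|z s' - z s| = `|z v - z u| ->
      `|z s'| + e <= expR (K * (v - u)) * (`|z s| + e).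
    move=> Hs ss'.
    have zts : `|z t| <= `|z s| + e.
      by rewrite -lerBlDl; apply: le_trans (lerB_dist _ _) _; rewrite distrC.
    apply: le_trans (_ : (1 + K * (v - u)) * (`|z s| + e) <= _); last first.
      by rewrite ler_wpM2r ?expR_ge1Dx// addr_ge0// ltW.
    have : `|z s'| <= `|z s| + `|z v - z u|.
      by rewrite -ss' -lerBlDl lerB_dist.
    have : (v - u) * (M * `|z t| + e) <= (v - u) * (K * (`|z s| + e)).
      apply: ler_wpM2l => //; have := ler_wpM2l M0 zts; rewrite /K.
      by have := normr_ge0 (z s); lra.
    lra.
  by split; apply: step => //; rewrite distrC.
Qed.

(** * Antiderivatives of continuous maps *)

Section antiderivative.
Context {R : realType} {V : normedModType R}.
Implicit Types (F G : R -> V).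

(** Differentiability up to a fixed error rate [e]: weak enough for piecewise affine functions,
    local enough to be built by Cousin's lemma. *)
Definition approx_antideriv F (e a b : R) G := forall t, a <= t -> t <= b ->
  exists2 r, 0 < r & forall u v, a <= u -> u <= t -> t <= v -> v <= b ->
    v - u < r -> `|G v - G u - (v - u) *: F t| <= e * (v - u).

(** The second piece is shifted by [G1 b - G2 b] to agree with the first at [b]; an interval
    straddling [b] is split there and the errors add. *)
Lemma approx_antideriv_cat F (e a b c : R) : a <= b -> b <= c -> 0 < e ->
  (exists G, approx_antideriv F e a b G) ->
  (exists G, approx_antideriv F e b c G) ->
  exists G, approx_antideriv F e a c G.
Proof.
move=> ab bc e0 [G1 H1] [G2 H2].
pose G s := if s <= b then G1 s else G2 s + (G1 b - G2 b).
have Gl s : s <= b -> G s = G1 s by rewrite /G => ->.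
have Gr s : b <= s -> G s = G2 s + (G1 b - G2 b).
  rewrite /G le_eqVlt => /predU1P[<-|]; first by rewrite lexx addrC subrK.
  by rewrite ltNge => /negbTE ->.
exists G => t at_ tc; have [tb|bt|tE] := ltgtP t b.
- have [r r0 Hr] := H1 t at_ (ltW tb).
  exists (Num.min r (b - t)); first by rewrite lt_min r0 subr_gt0.
  move=> u v au ut tv vc; rewrite lt_min => /andP[uvr uvb].
  by rewrite !Gl; try lra; apply: Hr => //; lra.
- have [r r0 Hr] := H2 t (ltW bt) tc.
  exists (Num.min r (t - b)); first by rewrite lt_min r0 subr_gt0.
  move=> u v au ut tv vc; rewrite lt_min => /andP[uvr uvb].
  rewrite !Gr; try lra.
  by rewrite (opprD (G2 u)) addrACA subrr addr0; apply: Hr => //; lra.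
- have bb : b <= b by [].
  have [r r0 Hr] := H1 b ab bb; have [q q0 Hq] := H2 b bb bc.
  exists (Num.min r q); first by rewrite lt_min r0.
  move=> u v au ut tv vc; rewrite lt_min => /andP[uvr uvq].
  rewrite tE in ut tv *; rewrite Gr// Gl//.
  have -> : G2 v + (G1 b - G2 b) - G1 u - (v - u) *: F b =
      (G2 v - G2 b - (v - b) *: F b) + (G1 b - G1 u - (b - u) *: F b).
    have -> : v - u = (v - b) + (b - u) by ring.
    rewrite scalerDl (opprD (_ *: _)) [RHS]addrACA; congr (_ + _).
    by rewrite (addrC (G1 b)) -!addrA.
  apply: le_trans (ler_normD _ _) _.
  have -> : e * (v - u) = e * (v - b) + e * (b - u) by ring.
  by apply: lerD; [apply: Hq|apply: Hr] => //; lra.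
Qed.

Lemma approx_antideriv_ex F (e b : R) : cont_on_nonneg F -> 0 <= b -> 0 < e ->
  exists G, approx_antideriv F e 0 b G.
Proof.
move=> cF b0 e0.
apply: (@tagged_interval_induction _ (fun u v =>
  exists G, approx_antideriv F e u v G)) => //.
  by move=> u v w _ uv vw _; exact: approx_antideriv_cat.
move=> t t0 tb; have e2 : 0 < e / 2 by rewrite divr_gt0.
have [r r0 Hr] := cF t t0 _ e2; exists r => // u v u0 ut tv vb uvr.
exists (fun s => s *: F t) => s us sv; exists 1 => // p q up ps sq qv _.
rewrite -scalerBl -scalerBr normrZ ger0_norm ?subr_ge0; last exact: le_trans sq.
rewrite mulrC ler_wpM2r ?subr_ge0//; first exact: le_trans sq.
have close x : u <= x -> x <= v -> `|F x - F t| <= e / 2.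
  by move=> ux xv; apply: Hr; [lra|rewrite ltr_norml; apply/andP; split; lra].
have := close s us sv; rewrite distrC; lra.
Qed.

End antiderivative.

(** This stands in for the integral of a Banach-valued continuous map: approximate antiderivatives
    [G n] on [[0, n]] with error rate [1 / (n + 1)] have convergent increments. *)
Lemma antiderivative_ex {R : realType} {V : completeNormedModType R}
    (F : R -> V) : cont_on_nonneg F ->
  exists G, forall t, 0 <= t -> has_deriv G t (F t).
Proof.
move=> cF; pose e n : R := n.+1%:R^-1.
have e0 n : 0 < e n by rewrite invr_gt0.
have /choice[G HG] n : exists G, approx_antideriv F (e n) 0 n%:R G.
  exact: approx_antideriv_ex.
(* On short intervals both increments are close to the length times [F t]. The error stays
   proportional to [v - u], which is what makes the limit differentiable. *)
have diff n m u v : (n <= m)%N -> 0 <= u -> u <= v -> v <= n%:R ->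
    `|(G n v - G n u) - (G m v - G m u)| <= 2 * e n * (v - u).
  move=> nm u0 uv vn.
  apply: (@tagged_interval_induction _ (fun u v =>
    `|(G n v - G n u) - (G m v - G m u)| <= 2 * e n * (v - u))) => //.
    move=> x y w _ _ _ _ Hxy Hyw.
    rewrite -(subrKA (G n y) (G n w)) -(subrKA (G m y) (G m w)) opprD addrACA.
    by apply: le_trans (ler_normD _ _) _; lra.
  have nm' : n%:R <= m%:R :> R by rewrite ler_nat.
  have emn : e m <= e n by rewrite lef_pV2 ?posrE// ler_nat.
  move=> t ut tv; have t0 : 0 <= t by lra.
  have tn : t <= n%:R by lra.
  have [r r0 Hr] := HG n t t0 tn.
  have [q q0 Hq] := HG m t t0 (le_trans tn nm').
  exists (Num.min r q); first by rewrite lt_min r0.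
  move=> x y ux xt ty yv; rewrite lt_min => /andP[xyr xyq].
  rewrite -(subrKA ((y - x) *: F t)).
  apply: le_trans (ler_normD _ _) _; rewrite (distrC _ (G m y - G m x)).
  have x0 : 0 <= x by lra.
  have yn : y <= n%:R by lra.
  have {}Hr := Hr x y x0 xt ty yn xyr.
  have {}Hq := Hq x y x0 xt ty (le_trans yn nm') xyq.
  apply: le_trans (lerD Hr Hq) _.
  have : e m * (y - x) <= e n * (y - x) by rewrite ler_wpM2r// subr_ge0; lra.
  lra.
have ecvg (v : R) : 2 * e n * v @[n --> \oo] --> 0.
  rewrite (_ : 0 = 2 * 0 * v); last by rewrite mulr0 mul0r.
  by apply: cvgMr_tmp; apply: cvgMl_tmp; exact: cvg_harmonic.
(* Only indices from [Num.bound t] on count, since [G n] is controlled on [[0, n]]; for negative [t]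
   the value 0 is arbitrary. *)
have /choice[H HH] t : exists l, 0 <= t -> forall n, (Num.bound t <= n)%N ->
    `|G n t - G n 0 - l| <= 2 * e n * t.
  have [t0|t0] := leP 0 t; last by exists 0.
  have [|l Hl] := @cauchy_bound_lim _ _ (fun n => G n t - G n 0)
      (fun n => 2 * e n * t) (Num.bound t) (ecvg t); last by exists l.
  move=> n m Nn nm; rewrite -[X in _ * X](subr0 t); apply: diff => //.
  by apply: le_trans (ltW (archi_boundP t0)) _; rewrite ler_nat.
have diffH n u v : 0 <= u -> u <= v -> v <= n%:R ->
    `|(G n v - G n u) - (H v - H u)| <= 2 * e n * (v - u).
  move=> u0 uv vn; apply/ler_addgt0Pr => r r0.
  have /cvgrPdist_le/(_ r r0) [M _ HM] := ecvg (v + u).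
  pose m := maxn (maxn n M) (maxn (Num.bound v) (Num.bound u)).
  have [nm Mm vm um] : [/\ (n <= m)%N, (M <= m)%N, (Num.bound v <= m)%N &
      (Num.bound u <= m)%N].
    by rewrite /m; split; rewrite !leq_max leqnn ?orbT.
  have v0 : 0 <= v by lra.
  rewrite -(subrKA (G m v - G m u)); apply: le_trans (ler_normD _ _) _.
  apply: lerD; first exact: diff.
  apply: le_trans (HM m Mm); rewrite sub0r normrN ger0_norm; last first.
    by rewrite mulr_ge0 ?addr_ge0// mulr_ge0 // ltW.
  rewrite mulrDr; apply: le_trans (lerD (HH v v0 m vm) (HH u u0 m um)).
  have -> : G m v - G m u - (H v - H u) =
      (G m v - G m 0 - H v) - (G m u - G m 0 - H u).
    by rewrite (opprD (G m u - G m 0)) [RHS]addrACA (opprB (G m u)) subrKA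
      (opprB (H v)) opprK (addrC (H u)).
  exact: ler_normB.
exists H => t t0; apply/has_derivP => r r0.
(* The interval [[0, n]] reaches beyond [t] by 1, and [3 * e n <= r] pays [2 * e n] for passing from
   [H] to [G n] and [e n] for [G n] itself. *)
pose n := maxn (Num.bound (t + 1)) (Num.bound (3 / r)).
have tn : t + 1 <= n%:R.
  have t10 : 0 <= t + 1 by lra.
  by apply: le_trans (ltW (archi_boundP t10)) _; rewrite ler_nat leq_maxl.
have er : 3 * e n <= r.
  have r3 : 0 <= 3 / r by rewrite divr_ge0 // ltW.
  rewrite /e ler_pdivrMr// mulrC -ler_pdivrMr//.
  apply: le_trans (ltW (archi_boundP r3)) _; rewrite ler_nat.
  exact: leqW (leq_maxr _ _).
have tn' : t <= n%:R by lra.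
have [q q0 Hq] := HG n t t0 tn'.
have est u v : 0 <= u -> u <= t -> t <= v -> v - u < Num.min q 1 ->
    `|H v - H u - (v - u) *: F t| <= r * (v - u).
  move=> u0 ut tv; rewrite lt_min => /andP[uvq uv1].
  have uv : u <= v by lra.
  have vn : v <= n%:R by lra.
  rewrite -(subrKA (G n v - G n u)); apply: le_trans (ler_normD _ _) _.
  rewrite distrC; apply: le_trans (lerD (diffH n u v u0 uv vn)
    (Hq u v u0 ut tv vn uvq)) _.
  have := ler_wpM2r _ er; move/(_ (v - u)); rewrite subr_ge0 => /(_ uv); lra.
exists (Num.min q 1); first by rewrite lt_min q0 ltr01.
move=> s s0 sq; have [ts|st] := leP t s.
  have st0 : 0 <= s - t by lra.
  by rewrite (ger0_norm st0) in sq *; exact: est.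
have st0 : 0 <= t - s by lra.
rewrite (distrC s) (ger0_norm st0) in sq *.
have -> : H s - H t - (s - t) *: F t = - (H t - H s - (t - s) *: F t).
  by rewrite opprB (opprB (H t)) [RHS]addrC -(opprB t s) scaleNr opprK.
by rewrite normrN; apply: est => //; exact: ltW.
Qed.

(** * Chain rule and bounds from operator norms *)

(** The inner derivative is taken on the half-line, the outer one on the whole line. The error is
    the outer remainder, where [h] is at most [|l| + 1] times [|s - t|] in norm, plus [dg] times the
    inner remainder. *)
Lemma has_deriv_comp {R : realType} (phi g : R -> R) (t l dg : R) :
  has_deriv (phi : R -> R^o) t l -> is_derive (phi t) 1 g dg ->
  has_deriv (g \o phi : R -> R^o) t (dg * l).
Proof.
move=> phil gd.
have gP e : 0 < e -> exists2 r, 0 < r & forall h, `|h| < r ->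
    `|g (phi t + h) - g (phi t) - h * dg| <= e * `|h|.
  move=> e0; have gc := @ex_derive _ _ _ _ _ _ _ gd.
  have : (fun h => h^-1 *: ((g \o shift (phi t)) (h *: 1) - g (phi t))) @ 0^'
      --> dg.
    by rewrite -(@derive_val _ _ _ _ _ _ _ gd); exact: gc.
  move=> /cvgrPdist_le/(_ e e0)[r /= r0 Hr]; exists r => // h hr.
  have [->|h0] := eqVneq h 0; first by rewrite addr0 mul0r !subrr normr0 mulr0.
  have := Hr h; rewrite /= sub0r normrN => /(_ hr h0).
  have h0' : 0 < `|h| by rewrite normr_gt0.
  rewrite -(ler_pM2r h0') -normrM; congr (_ <= _).
  rewrite -normrN /GRing.scale /= mulr1 (addrC h); congr `|_|.
  by field.
apply/has_derivP => e e0.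
have ld0 : 0 < `|l| + 1 by rewrite ltr_wpDl.
have d0 : 0 < `|dg| + 1 by rewrite ltr_wpDl.
have e1 : 0 < e / (2 * (`|l| + 1)) by rewrite divr_gt0 ?mulr_gt0.
have e2 : 0 < e / (2 * (`|dg| + 1)) by rewrite divr_gt0 ?mulr_gt0.
have [r r0 Hr] := gP _ e1.
have r2 : 0 < r / 2 by rewrite divr_gt0.
have [q q0 Hq] := has_deriv_cvg phil _ r2.
have /has_derivP phil' := phil.
have [p p0 Hp] := phil' _ e2.
have [p' p'0 Hp'] := phil' _ ltr01.
exists (Num.min q (Num.min p p')); first by rewrite !lt_min q0 p0.
move=> s s0; rewrite !lt_min => /and3P[sq sp sp'].
pose h := phi s - phi t.
have hr : `|h| < r by apply: le_lt_trans (Hq s s0 sq) _; lra.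
have {}Hr := Hr h hr.
have {}Hp := Hp s s0 sp; have {}Hp' := Hp' s s0 sp'.
rewrite /GRing.scale /= -/h in Hp Hp' *.
rewrite (_ : phi t + h = phi s) in Hr; last by rewrite /h; ring.
have hl : `|h| <= (`|l| + 1) * `|s - t|.
  rewrite -(subrK ((s - t) * l) h); apply: le_trans (ler_normD _ _) _.
  by rewrite normrM; lra.
have -> : g (phi s) - g (phi t) - (s - t) * (dg * l) =
  (g (phi s) - g (phi t) - h * dg) + dg * (h - (s - t) * l) by ring.
apply: le_trans (ler_normD _ _) _; rewrite normrM.
have H1 : e / (2 * (`|l| + 1)) * `|h| <= e / 2 * `|s - t|.
  apply: le_trans (ler_wpM2l (ltW e1) hl) _.
  by rewrite le_eqVlt; apply/orP; left; apply/eqP; field; rewrite gt_eqF.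
have H2 : `|dg| * `|h - (s - t) * l| <= e / 2 * `|s - t|.
  apply: le_trans (_ : (`|dg| + 1) * (e / (2 * (`|dg| + 1)) * `|s - t|) <= _).
    by apply: ler_pM => //; rewrite lerDl.
  by rewrite le_eqVlt; apply/orP; left; apply/eqP; field; rewrite gt_eqF.
lra.
Qed.

Lemma linear_cont_bounded {R : realType} {V : normedModType R}
    (L : {linear V -> V}) : continuous L ->
  exists2 M, 0 <= M & forall v, `|L v| <= M * `|v|.
Proof.
move=> /linear_bounded_continuous/linear_boundedP[M [_ HM]].
exists (`|M| + 1); first by rewrite addr_ge0.
by apply: HM; rewrite ltr_pwDr// ler_norm.
Qed.

Lemma opnorm_le {R : realType} {V : normedModType R} (L : V -> V) (M : R) :
  linear L -> (opnorm L <= M%:E)%E -> forall v, `|L v| <= M * `|v|.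
Proof.
move=> linL LM v; have [->|v0] := eqVneq v 0.
  by rewrite (linear_0E linL) !normr0 mulr0.
have nv : 0 < `|v| by rewrite normr_gt0.
have : (`|L (`|v|^-1 *: v)|%:E <= M%:E)%E.
  apply: le_trans LM; apply: ereal_sup_ubound; exists (`|v|^-1 *: v) => //=.
  by rewrite normrZ normfV normr_id mulVf ?gt_eqF.
rewrite lee_fin (linear_scaleE linL) normrZ normfV normr_id mulrC.
by rewrite ler_pdivrMr.
Qed.

(** * The evolution family *)

Section evolution.
Context {R : realType} {X : normedModType R}.
Variables (A : R -> {linear X -> X}) (T : R -> R -> X -> X).
Hypothesis A_bounded : forall t, 0 <= t -> continuous (A t).
Hypothesis A_continuous : opnorm_continuous (fun t => A t : X -> X).
Hypothesis T_evol : is_evolution_family (fun t => A t : X -> X) T.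

(** Compactness of [[0, b]] through Cousin's lemma: near [t] the norm of [A s - A t] stays below 1,
    and joining two intervals adds their bounds. *)
Lemma generator_locally_bounded (b : R) : 0 <= b -> exists2 M, 0 <= M &
  forall t v, 0 <= t -> t <= b -> `|A t v| <= M * `|v|.
Proof.
move=> b0.
suff [M M0 HM] : exists2 M, 0 <= M & forall t, 0 <= t -> t <= b ->
    forall v, `|A t v| <= M * `|v|.
  by exists M => // t v t0 tb; exact: HM.
apply: (@tagged_interval_induction _ (fun u v => exists2 M, 0 <= M &
  forall t, u <= t -> t <= v -> forall x, `|A t x| <= M * `|x|)) => //.
  move=> u v w _ _ _ _ [M M0 HM] [N N0 HN]; exists (M + N).
    exact: addr_ge0.
  move=> t ut tw x; rewrite mulrDl; have [tv|vt] := leP t v.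
    by apply: le_trans (HM t ut tv x) _; rewrite lerDl mulr_ge0.
  by apply: le_trans (HN t (ltW vt) tw x) _; rewrite lerDr mulr_ge0.
move=> t t0 tb; have [K K0 HK] := linear_cont_bounded _ (A_bounded t t0).
have /fine_cvgP[[r1 /= r10 H1] /cvgrPdist_lt/(_ 1 ltr01)[r2 /= r20 H2]] :=
  A_continuous t t0.
exists (Num.min r1 r2); first by rewrite lt_min r10.
move=> u v u0 ut tv vb; rewrite lt_min => /andP[uvr1 uvr2].
exists (K + 1); first by rewrite addr_ge0.
move=> s us sv x.
have st : `|t - s| <= v - u by rewrite ler_norml; apply/andP; split; lra.
have s0 : 0 <= s by lra.
have {}H1 := H1 s (le_lt_trans st uvr1) s0.
have {}H2 := H2 s (le_lt_trans st uvr2) s0.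
have linD : linear (A s \- A t).
  by move=> a v1 v2 /=; rewrite !linearP (scalerDr a) addrACA.
have := @opnorm_le _ _ _ 1 linD _ x; rewrite -[opnorm _]fineK//= lee_fin.
move=> Hx; have {}Hx : `|A s x - A t x| <= 1 * `|x|.
  apply: Hx; apply/ltW; apply: le_lt_trans H2; rewrite sub0r normrN /=.
  exact: ler_norm.
rewrite -(subrK (A t x) (A s x)); apply: le_trans (ler_normD _ _) _.
by apply: le_trans (lerD Hx (HK x)) _; lra.
Qed.

(** Gronwall's inequality in both directions of time, with [M] common to all solutions; uniqueness
    and the bounds on [T] both come from it. *)
Lemma homogeneous_bound (b : R) : 0 <= b -> exists2 M, 0 <= M &
  forall z : R -> X, (forall t, 0 <= t -> has_deriv z t (A t (z t))) ->
  forall t s, 0 <= t -> 0 <= s -> t <= b -> s <= b -> `|z t| <= M * `|z s|.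
Proof.
move=> b0; have [M M0 HM] := generator_locally_bounded b b0.
exists (expR ((M + 1) * b)); first exact: expR_ge0.
move=> z zA.
have main t s : 0 <= t -> t <= s -> s <= b ->
    `|z s| <= expR ((M + 1) * b) * `|z t| /\
    `|z t| <= expR ((M + 1) * b) * `|z s|.
  move=> t0 ts sb.
  have [|x tx xs|H1 H2] := @gronwall_two_sided _ _ z (fun t => A t (z t)) M t s
    t0 ts M0.
  - by move=> x tx xs; apply: zA; exact: le_trans tx.
  - by apply: HM; [exact: le_trans tx|exact: le_trans sb].
  have : expR ((M + 1) * (s - t)) <= expR ((M + 1) * b).
    by rewrite ler_expR; apply: ler_wpM2l; lra.
  move=> E; split; [apply: le_trans H1 _|apply: le_trans H2 _];
    by rewrite ler_wpM2r.
move=> t s t0 s0 tb sb; have [ts|/ltW st] := leP t s.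
- by have [] := main t s t0 ts sb.
- by have [] := main s t s0 st tb.
Qed.

(** The difference of the two solutions vanishes at [s], hence at [t] by the bound for homogeneous
    solutions. The cocycle identity and the linearity of [T t s] are instances, for suitable [z]. *)
Lemma evolution_unique (z : R -> X) (s t : R) :
  (forall r, 0 <= r -> has_deriv z r (A r (z r))) -> 0 <= s -> 0 <= t ->
  T t s (z s) = z t.
Proof.
move=> zA s0 t0.
have [M M0 HM] := homogeneous_bound (s + t) (addr_ge0 s0 t0).
have [Tss Td] := T_evol s (z s) s0.
have := HM (fun r => T r s (z s) - z r) _ t s t0 s0.
rewrite Tss subrr normr0 mulr0 lerDl lerDr => H; apply/eqP.
rewrite -subr_eq0 -normr_le0; apply: H => // r r0.
by rewrite linearB; apply: has_derivB; [exact: Td|exact: zA].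
Qed.

Lemma evolution_id (s : R) v : 0 <= s -> T s s v = v.
Proof. by move=> /(T_evol s v)[]. Qed.

Lemma evolution_deriv (t s : R) v : 0 <= t -> 0 <= s ->
  has_deriv (fun r => T r s v) t (A t (T t s v)).
Proof. by move=> t0 /(T_evol s v)[_]; exact. Qed.

Lemma evolution_comp (t s r : R) v : 0 <= t -> 0 <= s -> 0 <= r ->
  T t s (T s r v) = T t r v.
Proof.
move=> t0 s0 r0; apply: (evolution_unique (fun q => T q r v)) => // q q0.
exact: evolution_deriv.
Qed.

Lemma evolution_linear (t s : R) : 0 <= t -> 0 <= s -> linear (T t s).
Proof.
move=> t0 s0 a v w.
rewrite -{1}(evolution_id s v)// -{1}(evolution_id s w)//.
apply: (evolution_unique (fun q => a *: T q s v + T q s w)) => // q q0.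
by rewrite linearP; apply: has_derivD; [apply: has_derivZ|];
  exact: evolution_deriv.
Qed.

Lemma evolution_bounded (b : R) : 0 <= b -> exists2 M, 0 <= M &
  forall t s v, 0 <= t -> 0 <= s -> t <= b -> s <= b ->
    `|T t s v| <= M * `|v|.
Proof.
move=> b0; have [M M0 HM] := homogeneous_bound b b0.
exists M => // t s v t0 s0 tb sb; rewrite -{2}(evolution_id s v)//.
apply: (HM (fun r => T r s v)) => // r r0; exact: evolution_deriv.
Qed.

Lemma evolution_bounded_near (t r : R) : 0 <= t -> 0 <= r -> exists2 M, 0 <= M &
  forall s, 0 <= s -> `|s - t| < 1 ->
    (forall v, `|T r s v| <= M * `|v|) /\ (forall v, `|T s r v| <= M * `|v|).
Proof.
move=> t0 r0; have b0 : 0 <= t + 1 + r by lra.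
have [M M0 HM] := evolution_bounded _ b0; exists M => // s s0.
rewrite ltr_norml => /andP[_ st1].
by split=> v; apply: HM; lra.
Qed.

(** Since [T r s v - T r t v = T r s (v - T s t v)], continuity in the initial time follows from
    continuity in the final time and a uniform bound on [T r s]. *)
Lemma evolution_initial_cvg (t r : R) v : 0 <= t -> 0 <= r ->
  forall e : R, 0 < e -> exists2 d, 0 < d & forall s, 0 <= s -> `|s - t| < d ->
    `|T r s v - T r t v| <= e.
Proof.
move=> t0 r0 e e0; have [M M0 HM] := evolution_bounded_near t r t0 r0.
have M1 : 0 < M + 1 by lra.
have [d d0 Hd] :=
  has_deriv_cvg (evolution_deriv t t v t0 t0) _ (divr_gt0 e0 M1).
exists (Num.min d 1); first by rewrite lt_min d0 ltr01.
move=> s s0; rewrite lt_min => /andP[sd s1].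
have [H1 _] := HM s s0 s1; have {}Hd := Hd s s0 sd.
rewrite evolution_id// in Hd.
rewrite -(evolution_comp r s t)// -(linear_subE (evolution_linear r s r0 s0)).
apply: le_trans (H1 _) _; rewrite distrC.
apply: le_trans (_ : (M + 1) * (e / (M + 1)) <= _).
  by apply: ler_pM => //; lra.
by rewrite mulrC divfK ?gt_eqF.
Qed.

(* [T r s v - T r t v = T r s (v - T s t v)], and [v - T s t v] vanishes at
   [s = t], so only its derivative matters. *)
Lemma evolution_deriv_initial (t r : R) v : 0 <= t -> 0 <= r ->
  has_deriv (fun s => T r s v) t (- T r t (A t v)).
Proof.
move=> t0 r0; have [M M0 HM] := evolution_bounded_near t r t0 r0.
pose S s := T r s; pose u s := v - T s t v.
have -> : - T r t (A t v) = 0 + T r t (0 - A t v).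
  by rewrite (linear_subE (evolution_linear r t r0 t0))
    (linear_0E (evolution_linear r t r0 t0)) add0r sub0r.
have du : has_deriv u t (0 - A t v).
  apply: has_derivB; first exact: has_deriv_cst.
  by rewrite -{2}(evolution_id t v)//; exact: evolution_deriv.
have : has_deriv (fun s => S s (u s)) t (0 + S t (0 - A t v)).
  apply: (@has_deriv_app _ _ S u t 0 _ M 1) => //.
  - by move=> s s0; exact: evolution_linear.
  - by move=> s s0 /(HM s s0)[].
  - exact: evolution_initial_cvg.
  (* As [u t = 0], the family [S] is differentiated at the zero vector only, where it is
     constant. *)
  - rewrite /u evolution_id// subrr.
    apply/has_derivP => e e0; exists 1 => // s s0 _.
    rewrite /S !(linear_0E (evolution_linear _ _ _ _))// subrr scaler0 subrr.
    by rewrite normr0 mulr_ge0 // ltW.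
move=> /has_derivP H; apply/has_derivP => e e0; have [d d0 Hd] := H e e0.
exists d => // s s0 sd; have := Hd s s0 sd.
rewrite /S /u evolution_id// subrr (linear_0E (evolution_linear _ _ _ _))//.
rewrite subr0 (linear_subE (evolution_linear _ _ _ _))// evolution_comp//.
Qed.

(** The derivative in the initial time contributes [- T r t (A t (u t))]: pulling back removes the
    generator and leaves the inhomogeneity. *)
Lemma evolution_pullback_deriv (r t : R) (u : R -> X) du : 0 <= r -> 0 <= t ->
  has_deriv u t du ->
  has_deriv (fun s => T r s (u s)) t (T r t (du - A t (u t))).
Proof.
move=> r0 t0 udu; have [M M0 HM] := evolution_bounded_near t r t0 r0.
rewrite (linear_subE (evolution_linear r t r0 t0)) addrC.
apply: (@has_deriv_app _ _ (T r) u t _ _ M 1) => //.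
- by move=> s s0; exact: evolution_linear.
- by move=> s s0 /(HM s s0)[].
- exact: evolution_initial_cvg.
- exact: evolution_deriv_initial.
Qed.

(** Variation of constants: pushing forward an antiderivative of the pulled-back forcing solves the
    forced linear equation. *)
Lemma evolution_pushforward_deriv (r t : R) (u : R -> X) du :
  0 <= r -> 0 <= t -> has_deriv u t du ->
  has_deriv (fun s => T s r (u s)) t (A t (T t r (u t)) + T t r du).
Proof.
move=> r0 t0 udu; have [M M0 HM] := evolution_bounded_near t r t0 r0.
apply: (@has_deriv_app _ _ (fun s => T s r) u t _ _ M 1) => //.
- by move=> s s0; exact: evolution_linear.
- by move=> s s0 /(HM s s0)[].
- by apply: has_deriv_cvg; exact: evolution_deriv.
- exact: evolution_deriv.
Qed.

Lemma evolution_pullback_cont (r : R) (F : R -> X) : 0 <= r ->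
  cont_on_nonneg F -> cont_on_nonneg (fun s => T r s (F s)).
Proof.
move=> r0 cF t t0 e e0; have [M M0 HM] := evolution_bounded_near t r t0 r0.
have M1 : 0 < M + 1 by lra.
have e2 : 0 < e / 2 by rewrite divr_gt0.
have [p p0 Hp] := cF t t0 _ (divr_gt0 e2 M1).
have [q q0 Hq] := evolution_initial_cvg t r (F t) t0 r0 _ e2.
exists (Num.min 1 (Num.min p q)); first by rewrite !lt_min ltr01 p0.
move=> s s0; rewrite !lt_min => /and3P[s1 sp sq].
have [H1 _] := HM s s0 s1.
rewrite -(subrKA (T r s (F t))) -(linear_subE (evolution_linear r s r0 s0)).
apply: le_trans (ler_normD _ _) _.
have -> : e = (M + 1) * (e / 2 / (M + 1)) + e / 2 by field; rewrite gt_eqF.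
apply: lerD; last exact: Hq.
apply: le_trans (H1 _) _; apply: ler_pM => //; [lra|exact: Hp].
Qed.

End evolution.

(** * Real powers and monotone functions *)

Lemma has_deriv_powR {R : realType} (phi : R -> R) (t l a : R) : 0 < phi t ->
  has_deriv (phi : R -> R^o) t l ->
  has_deriv ((fun s => phi s `^ a) : R -> R^o) t (a * phi t `^ (a - 1) * l).
Proof.
move=> phi0 phil.
exact: (has_deriv_comp phi (fun x => x `^ a) t l _ phil
  (is_derive1_powR a phi0)).
Qed.

Lemma powR_divN {R : realType} (a b x : R) : 0 < a -> 0 < b ->
  (a / b) `^ (- x) = a `^ (- x) * b `^ x.
Proof.
move=> a0 b0; rewrite powRM ?invr_ge0 ?ltW//; congr (_ * _).
by rewrite -powR_inv1 ?ltW// -powRrM mulN1r opprK.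
Qed.

Lemma powR_subr1 {R : realType} (a x : R) : 0 < a -> a `^ (x - 1) = a `^ x / a.
Proof.
by move=> a0; rewrite powRB ?powRr1 ?ltW// (gt_eqF a0) implybT.
Qed.

Lemma has_deriv_ge0 {R : realType} (phi : R -> R) (t l : R) : 0 <= t ->
    (forall s, t < s -> phi t < phi s) -> has_deriv (phi : R -> R^o) t l ->
  0 <= l.
Proof.
move=> t0 mphi /has_derivP H; apply/ler_addgt0Pr => e e0.
have [r r0 Hr] := H e e0; pose s := t + r / 2.
have ts : t < s by rewrite /s; lra.
have s0 : 0 <= s by lra.
have st : s - t = r / 2 by rewrite /s; ring.
have r2 : 0 < r / 2 by rewrite divr_gt0.
have := Hr s s0; rewrite /GRing.scale /= st gtr0_norm// => Hs.
have : r / 2 < r by lra.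
move=> /Hs; rewrite ler_norml => /andP[_ H2]; have := mphi s ts => H3.
rewrite -(ler_pM2l r2) mulr0; lra.
Qed.

(** * Admissibility *)

Section perturbation.
Context {R : realType} {X : completeNormedModType R}.
Variables (A : R -> {linear X -> X}) (T : R -> R -> X -> X).
Variables (mu dmu nu : R -> R) (P1 P2 : R -> {linear X -> X}).
Variables (D lambda d : R).
Hypothesis A_bounded : forall t, 0 <= t -> continuous (A t).
Hypothesis A_continuous : opnorm_continuous (fun t => A t : X -> X).
Hypothesis T_evol : is_evolution_family (fun t => A t : X -> X) T.
Hypothesis mu_increasing : forall s t, 0 <= s -> s < t -> mu s < mu t.
Hypothesis mu_deriv :
  forall t, 0 <= t -> has_deriv (mu : R -> R^o) t (dmu t).
Hypothesis mu0 : mu 0 = 1.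
Hypothesis mu_lim : mu t @[t --> +oo] --> +oo.
Hypothesis nu_ge1 : forall t, 0 <= t -> 1 <= nu t.
Hypothesis P1_cont : continuous (P1 0).
Hypothesis P2_cont : continuous (P2 0).
Hypothesis P_sum : forall v, P1 0 v + P2 0 v = v.
Hypothesis P1_inv : forall t s, 0 <= t -> 0 <= s -> forall v,
  T t s (P1 s v) = P1 t (T t s v).
Hypothesis P2_inv : forall t s, 0 <= t -> 0 <= s -> forall v,
  T t s (P2 s v) = P2 t (T t s v).
Hypothesis D_gt0 : 0 < D.
Hypothesis lambda_gt0 : 0 < lambda.
Hypothesis P1_bound : forall t s, 0 <= s -> s <= t ->
  (opnorm (T t s \o P1 s)
    <= (D * (mu t / mu s) `^ (- lambda) * nu s `^ d)%:E)%E.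
Hypothesis P2_bound : forall t s, 0 <= t -> t <= s ->
  (opnorm (T t s \o P2 s)
    <= (D * (mu s / mu t) `^ (- lambda) * nu s `^ d)%:E)%E.

Local Notation weight t := (dmu t / (mu t * nu t `^ d)).

Let Tlin := evolution_linear A T A_bounded A_continuous T_evol.
Let Tcomp := evolution_comp A T A_bounded A_continuous T_evol.
Let Tid := evolution_id A T T_evol.
Let Tbnd := evolution_bounded A T A_bounded A_continuous T_evol.

Lemma mu_gt0 t : 0 <= t -> 0 < mu t.
Proof.
rewrite le_eqVlt => /predU1P[<-|t0]; first by rewrite mu0.
by apply: lt_trans (mu_increasing 0 t (lexx _) t0); rewrite mu0.
Qed.

Lemma dmu_ge0 t : 0 <= t -> 0 <= dmu t.
Proof.
move=> t0; apply: (@has_deriv_ge0 _ mu t) => //; last exact: mu_deriv.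
by move=> s; exact: mu_increasing.
Qed.

Lemma weight_ge0 t : 0 <= t -> 0 <= weight t.
Proof.
by move=> t0; rewrite divr_ge0 ?dmu_ge0// mulr_ge0 ?powR_ge0// ltW ?mu_gt0.
Qed.

(** For fixed [t] the map [T t 0 \o P 0] is bounded and linear, hence commutes with differentiation;
    invariance and the cocycle identity then bring out [T t s \o P s], which the dichotomy
    bounds. *)
Lemma projected_has_deriv (P : R -> {linear X -> X}) (H e : R -> X) (t s : R) :
  continuous (P 0) ->
  (forall v, T 0 s (P s v) = P 0 (T 0 s v)) -> 0 <= t -> 0 <= s ->
  has_deriv H s (T 0 s (e s)) ->
  has_deriv (fun r => T t 0 (P 0 (H r))) s (T t s (P s (e s))).
Proof.
move=> Pc Pinv t0 s0 He; have [K K0 HK] := linear_cont_bounded _ Pc.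
have [M M0 HM] := Tbnd t t0.
rewrite -(Tcomp t 0 s)// Pinv.
apply: (@has_deriv_lin _ _ (fun v => T t 0 (P 0 v)) H s _ (M * K)) => //.
  by move=> a v w; rewrite linearP Tlin.
move=> v; apply: le_trans (HM t 0 _ t0 (lexx _) (lexx _) t0) _.
by rewrite -mulrA ler_wpM2l.
Qed.

(** The power of [nu s] in the dichotomy cancels the one in the weight. What remains is the
    logarithmic derivative of [mu], which has an explicit antiderivative once multiplied by a power
    of [mu]. *)
Lemma weight_bound (v : X) (K B s : R) (L : X -> X) : 0 <= s ->
  linear L -> (opnorm L <= (D * B * nu s `^ d)%:E)%E -> 0 <= B ->
  `|v| <= K * weight s -> `|L v| <= D * K * B * (dmu s / mu s).
Proof.
move=> s0 linL HL B0 Hv.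
apply: le_trans (opnorm_le _ _ linL HL v) _.
have n0 : 0 < nu s `^ d.
  by rewrite powR_gt0// (lt_le_trans ltr01)// nu_ge1.
have c0 : 0 <= D * B * nu s `^ d by rewrite !mulr_ge0 // ltW.
apply: le_trans (ler_wpM2l c0 Hv) _.
rewrite le_eqVlt; apply/orP; left; apply/eqP; field.
by rewrite !gt_eqF ?mu_gt0.
Qed.

Section residual.
Variables (H e : R -> X) (K : R).
Hypothesis K_ge0 : 0 <= K.
Hypothesis H_deriv : forall s, 0 <= s -> has_deriv H s (T 0 s (e s)).
Hypothesis e_bound : forall s, 0 <= s -> `|e s| <= K * weight s.

(** The integral of [D * K] times the dichotomy factor times [dmu / mu] is at most this, on the
    stable side [[0, t]] and on the unstable side from [t] on alike. *)
Let k := D * K / lambda.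

Let k_ge0 : 0 <= k.
Proof. by rewrite divr_ge0 ?mulr_ge0// ltW. Qed.

(** The comparison function is a multiple of the power [lambda] of [mu s], with derivative equal to
    the dichotomy bound at [s]; it is nonnegative and has the value [k] at [t]. *)
Lemma stable_increment t : 0 <= t ->
  `|T t 0 (P1 0 (H t)) - T t 0 (P1 0 (H 0))| <= k.
Proof.
move=> t0; pose q := mu t `^ (- lambda).
have q0 : 0 <= q by exact: powR_ge0.
apply: le_trans (_ : k * q * mu t `^ lambda - k * q * mu 0 `^ lambda <= _).
  apply: (@mean_value_le _ _ (fun s => T t 0 (P1 0 (H s)))
    (fun s => T t s (P1 s (e s))) (fun s => k * q * mu s `^ lambda)
    (fun s => k * q * (lambda * mu s `^ (lambda - 1) * dmu s))) => //.
  - move=> s s0 _; apply: projected_has_deriv => //; last exact: H_deriv.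
    by move=> v; exact: P1_inv.
  - move=> s s0 _; apply: (@has_derivZ _ R^o (k * q)).
    by apply: has_deriv_powR; [exact: mu_gt0|exact: mu_deriv].
  - move=> s s0 st; have m0 := mu_gt0 s s0.
    apply: le_trans (weight_bound _ K ((mu t / mu s) `^ (- lambda)) s
      (T t s \o P1 s) s0 _ _ _ _) _ => //.
    + by move=> a v w /=; rewrite linearP Tlin.
    + exact: P1_bound.
    + exact: powR_ge0.
    + exact: e_bound.
    rewrite powR_divN ?mu_gt0// -/q powR_subr1// /k.
    by rewrite le_eqVlt; apply/orP; left; apply/eqP; field; rewrite !gt_eqF.
rewrite mu0 powR1 mulr1 /q -[X in X - _]mulrA -powRD ?addNr ?powRr0.
  by rewrite mulr1 lerBlDr lerDl mulr_ge0.
by rewrite (gt_eqF (mu_gt0 t t0)) implybT.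
Qed.

(** The comparison function is minus a multiple of the power [- lambda] of [mu s]. The factor in
    [mu r] makes the unstable part Cauchy at infinity, and [r = t] turns the bound into [k]. *)
Lemma unstable_increment t r s : 0 <= t -> t <= r -> r <= s ->
  `|T t 0 (P2 0 (H s)) - T t 0 (P2 0 (H r))|
    <= k * mu t `^ lambda * mu r `^ (- lambda).
Proof.
move=> t0 tr rs; pose q := mu t `^ lambda.
have q0 : 0 <= q by exact: powR_ge0.
have r0 : 0 <= r by exact: le_trans tr.
apply: le_trans (_ : - (k * q) * mu s `^ (- lambda) -
    - (k * q) * mu r `^ (- lambda) <= _); last first.
  by rewrite !mulNr opprK addrC gerDl oppr_le0 mulr_ge0 ?powR_ge0// mulr_ge0.
apply: (@mean_value_le _ _ (fun s => T t 0 (P2 0 (H s)))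
  (fun s => T t s (P2 s (e s))) (fun s => - (k * q) * mu s `^ (- lambda))
  (fun s => - (k * q) * (- lambda * mu s `^ (- lambda - 1) * dmu s))) => //.
- move=> x rx _; have x0 : 0 <= x by exact: le_trans rx.
  apply: projected_has_deriv => //; last exact: H_deriv.
  by move=> v; exact: P2_inv.
- move=> x rx _; have x0 : 0 <= x by exact: le_trans rx.
  apply: (@has_derivZ _ R^o (- (k * q))).
  by apply: has_deriv_powR; [exact: mu_gt0|exact: mu_deriv].
- move=> x rx xs; have x0 : 0 <= x by exact: le_trans rx.
  have m0 := mu_gt0 x x0.
  apply: le_trans (weight_bound _ K ((mu x / mu t) `^ (- lambda)) x
    (T t x \o P2 x) x0 _ _ _ _) _ => //.
  + by move=> a v w /=; rewrite linearP Tlin.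
  + by apply: P2_bound => //; exact: le_trans rx.
  + exact: powR_ge0.
  + exact: e_bound.
  rewrite powR_divN ?mu_gt0// -/q powR_subr1// /k.
  by rewrite le_eqVlt; apply/orP; left; apply/eqP; field; rewrite !gt_eqF.
Qed.

Lemma mu_powN_cvg0 (B : R) : B * mu n%:R `^ (- lambda) @[n --> \oo] --> 0.
Proof.
rewrite -[X in _ --> X](mulr0 B); apply: cvgMl_tmp.
apply/cvgrPdist_le => r r0.
have /cvgryPge/(_ (r^-1 `^ lambda^-1)) Hmu : mu n%:R @[n --> \oo] --> +oo.
  by apply: (cvg_comp _ _ (@cvgr_idn R)).
near=> n.
rewrite sub0r normrN ger0_norm ?powR_ge0// powRN.
have m0 : 0 < mu n%:R by exact: mu_gt0.
rewrite invf_ple ?posrE ?powR_gt0//.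
have -> : r^-1 = (r^-1 `^ lambda^-1) `^ lambda.
  by rewrite -powRrM mulVf ?gt_eqF// powRr1// invr_ge0 ltW.
rewrite ge0_ler_powR ?nnegrE ?powR_ge0 ?(ltW lambda_gt0) ?(ltW m0)//.
by near: n; exact: Hmu.
Unshelve. all: by end_near. Qed.

(** The stable component of [xi] is read off at time 0, the unstable one is the limit at infinity of
    the Cauchy sequence [P2 0 (H n%:R)]; each contributes [k]. *)
Lemma bounded_correction : exists xi, forall t, 0 <= t ->
  `|T t 0 (xi - H t)| <= 2 * k.
Proof.
have inc n m : (n <= m)%N -> `|P2 0 (H n%:R) - P2 0 (H m%:R)| <=
    k * mu n%:R `^ (- lambda).
  move=> nm; have := unstable_increment 0 n%:R m%:R (lexx _).
  by rewrite !Tid // mu0 powR1 mulr1 distrC; apply; rewrite ?ler_nat.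
have [|L HL] := @cauchy_bound_lim _ _ (fun n => P2 0 (H n%:R))
  (fun n => k * mu n%:R `^ (- lambda)) 0 (mu_powN_cvg0 k).
  by move=> n m _; exact: inc.
exists (P1 0 (H 0) + L) => t t0.
have T0 := Tlin t 0 t0 (lexx _).
rewrite -(P_sum (H t)) opprD addrACA (linear_addE T0) !(linear_subE T0).
apply: le_trans (ler_normD _ _) _; rewrite (_ : 2 * k = k + k); last by ring.
apply: lerD; first by rewrite distrC; exact: stable_increment.
(* The limit [L] is compared through [H n%:R] with [n] beyond [t]: the increment from [t] to [n]
   costs [k], and the tail, even multiplied by the bound [M] of [T t 0], tends to 0. *)
apply/ler_addgt0Pr => r r0; have [M M0 HM] := Tbnd t t0.
have /cvgrPdist_le/(_ r r0) [N _ HN] := mu_powN_cvg0 (M * k).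
pose n := maxn N (Num.bound t).
have tn : t <= n%:R.
  by apply: le_trans (ltW (archi_boundP t0)) _; rewrite ler_nat leq_maxr.
rewrite -(subrKA (T t 0 (P2 0 (H n%:R)))); apply: le_trans (ler_normD _ _) _.
rewrite addrC; apply: lerD.
  apply: le_trans (unstable_increment t t n%:R t0 (lexx _) tn) _.
  rewrite -mulrA -powRD ?subrr ?powRr0 ?mulr1//.
  by rewrite (gt_eqF (mu_gt0 t t0)) implybT.
rewrite -(linear_subE T0).
apply: le_trans (HM t 0 _ t0 (lexx _) (lexx _) t0) _; rewrite distrC.
apply: le_trans (ler_wpM2l M0 (HL n (leq0n _))) _.
rewrite mulrA; apply: le_trans (ler_norm _) _.
by have := HN n (leq_maxl _ _); rewrite sub0r normrN.
Qed.
End residual.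

(** The vector [xi] selects the initial value of [w]: pushing [G + xi] forward solves the equation,
    and pulled back to time 0 its difference from [y] is [xi - H], which [bounded_correction]
    controls. *)
Lemma admissibility (F y dy : R -> X) (K : R) : cont_on_nonneg F -> 0 <= K ->
  (forall t, 0 <= t -> has_deriv y t (dy t)) ->
  (forall t, 0 <= t -> `|dy t - A t (y t) - F t| <= K * weight t) ->
  exists2 w, forall t, 0 <= t -> has_deriv w t (A t (w t) + F t) &
    forall t, 0 <= t -> `|w t - y t| <= 2 * D / lambda * K.
Proof.
move=> cF K0 yd yK.
have cTF := evolution_pullback_cont A T A_bounded A_continuous T_evol 0 F
  (lexx _) cF.
have [G HG] := antiderivative_ex _ cTF.
pose H s := T 0 s (y s) - G s.
pose e s := dy s - A s (y s) - F s.
have [|xi Hxi] := bounded_correction H e K K0 _ yK.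
  move=> s s0; rewrite /e (linear_subE (Tlin 0 s (lexx _) s0)).
  apply: has_derivB; last exact: HG.
  by apply: (evolution_pullback_deriv A T) => //; exact: yd.
exists (fun t => T t 0 (G t + xi)) => t t0.
  have -> : F t = T t 0 (T 0 t (F t)) by rewrite Tcomp// Tid.
  apply: (evolution_pushforward_deriv A T) => //.
  rewrite -[T 0 t _]addr0; apply: has_derivD; [exact: HG|exact: has_deriv_cst].
have yE : y t = T t 0 (T 0 t (y t)) by rewrite Tcomp// Tid.
rewrite {1}yE -(linear_subE (Tlin t 0 t0 (lexx _))).
have -> : G t + xi - T 0 t (y t) = xi - H t by rewrite opprB addrCA addrA.
by rewrite (_ : _ * K = 2 * (D * K / lambda)); [exact: Hxi|ring].
Qed.

End perturbation.

(** * Picard iteration *)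

Lemma cont_on_nonneg_graph {R : realType} {V : normedModType R}
    (f : R -> V -> V) (x : R -> V) :
  {within [set p : R * V | 0 <= p.1], continuous (fun p => f p.1 p.2)} ->
  cont_on_nonneg x -> cont_on_nonneg (fun t => f t (x t)).
Proof.
move=> /subspace_continuousP cf cx t t0 e e0.
have /cvgrPdist_le/(_ e e0) := cf (t, x t) t0.
move=> [[U W] /= [/nbhs_ballP[r /= r0 HU] /nbhs_ballP[q /= q0 HW]] UW].
have q2 : 0 < q / 2 by rewrite divr_gt0.
have [p p0 Hp] := cx t t0 _ q2.
exists (Num.min r p); first by rewrite lt_min r0.
move=> s s0; rewrite lt_min => /andP[sr sp].
rewrite distrC; apply: (UW (s, x s)) => //=; split.
  by apply: HU; rewrite -ball_normE /= distrC.
apply: HW; rewrite -ball_normE /= distrC.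
apply: le_lt_trans (Hp s s0 sp) _; lra.
Qed.

Lemma norm_le_cvg0_eq0 {R : realType} {V : normedModType R} (v : V)
    (e : nat -> R) : e n @[n --> \oo] --> 0 -> (forall n, `|v| <= e n) -> v = 0.
Proof.
move=> e0 ve; apply/eqP; rewrite -normr_le0; apply/ler_addgt0Pr => r r0.
have /cvgrPdist_le/(_ r r0)[N _ HN] := e0.
apply: le_trans (ve N) _; rewrite add0r.
by have := HN N (leqnn _); rewrite sub0r normrN; exact/le_trans/ler_norm.
Qed.

Lemma uniform_lim_cont_on_nonneg {R : realType} {V : normedModType R}
    (xn : nat -> R -> V) (x : R -> V) (e : nat -> R) : e n @[n --> \oo] --> 0 ->
  (forall n, cont_on_nonneg (xn n)) ->
  (forall n t, 0 <= t -> `|xn n t - x t| <= e n) -> cont_on_nonneg x.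
Proof.
move=> e0 cxn xnx t t0 r r0.
have r3 : 0 < r / 3 by rewrite divr_gt0.
have /cvgrPdist_le/(_ _ r3)[N _ /(_ N (leqnn _)) HN] := e0.
have {}HN : e N <= r / 3.
  by move: HN; rewrite sub0r normrN; exact/le_trans/ler_norm.
have [p p0 Hp] := cxn N t t0 _ r3; exists p => // s s0 sp.
rewrite -(subrKA (xn N s)) -[X in _ + X](subrKA (xn N t)).
apply: le_trans (ler_normD _ _) _; rewrite distrC.
apply: le_trans (lerD (xnx N s s0) (ler_normD _ _)) _.
by have := Hp s s0 sp; have := xnx N t t0; lra.
Qed.

Lemma picard_limit {R : realType} {V : completeNormedModType R}
    (xn : nat -> R -> V) (a rho : R) : 0 <= a -> 0 <= rho -> rho < 1 ->
  (forall n t, 0 <= t -> `|xn n.+1 t - xn n t| <= a * rho ^+ n) ->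
  exists x : R -> V, forall n t, 0 <= t ->
    `|xn n t - x t| <= a / (1 - rho) * rho ^+ n.
Proof.
move=> a0 rho0 rho1 xnd; have r1 : 0 < 1 - rho by lra.
(* Keeping the exact difference of powers makes the induction close as a geometric sum. *)
have tele t n k : 0 <= t ->
    `|xn n t - xn (n + k)%N t| <= a / (1 - rho) * (rho ^+ n - rho ^+ (n + k)).
  move=> t0; elim: k => [|k IH]; first by rewrite addn0 !subrr normr0 mulr0.
  rewrite addnS -(subrKA (xn (n + k)%N t)); apply: le_trans (ler_normD _ _) _.
  rewrite [X in _ + X]distrC; apply: le_trans (lerD IH (xnd _ _ t0)) _.
  rewrite exprS le_eqVlt; apply/orP; left; apply/eqP; field.
  by rewrite gt_eqF.
have /choice[x Hx] t : exists l, 0 <= t -> forall n,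
    `|xn n t - l| <= a / (1 - rho) * rho ^+ n.
  have [t0|t0] := leP 0 t; last by exists 0.
  have [||l Hl] := @cauchy_bound_lim _ _ (fun n => xn n t)
    (fun n => a / (1 - rho) * rho ^+ n) 0.
  - by apply: cvg_geometric; rewrite ger0_norm.
  - move=> n m _ nm; rewrite -(subnKC nm); apply: le_trans (tele _ _ _ t0) _.
    by rewrite ler_wpM2l ?divr_ge0 ?(ltW r1)// gerBl exprn_ge0.
  - by exists l => _ n; exact: Hl.
by exists x => n t t0; exact: Hx.
Qed.

Theorem corollary3p3 (R : realType) (X : completeNormedModType R)
  (A : R -> {linear X -> X}) (T : R -> R -> X -> X) (f : R -> X -> X)
  (mu dmu nu : R -> R)
  (P1 P2 P3 : R -> {linear X -> X})
  (D lambda d c : R)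
  (hA_bounded : forall t, 0 <= t -> continuous (A t))
  (hA_continuous : opnorm_continuous (fun t => A t : X -> X))
  (hT : is_evolution_family (fun t => A t : X -> X) T)
  (hf_continuous :
    {within [set p : R * X | 0 <= p.1], continuous (fun p => f p.1 p.2)})
  (hmu_increasing : forall s t, 0 <= s -> s < t -> mu s < mu t)
  (hmu_deriv : forall t, 0 <= t -> has_deriv (mu : R -> R^o) t (dmu t))
  (hmu0 : mu 0 = 1)
  (hmu_lim : mu t @[t --> +oo] --> +oo)
  (hnu : forall t, 0 <= t -> 1 <= nu t)
  (hP1 : forall t, 0 <= t -> is_projection (P1 t))
  (hP2 : forall t, 0 <= t -> is_projection (P2 t))
  (hP3 : forall t, 0 <= t -> is_projection (P3 t))
  (hP_sum : forall t, 0 <= t -> forall v, P1 t v + P2 t v + P3 t v = v)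
  (hP_orth : forall t, 0 <= t -> forall v,
    [/\ P1 t (P2 t v) = 0 /\ P2 t (P1 t v) = 0,
        P1 t (P3 t v) = 0 /\ P3 t (P1 t v) = 0 &
        P2 t (P3 t v) = 0 /\ P3 t (P2 t v) = 0])
  (hP_inv : forall t s, 0 <= t -> 0 <= s -> forall v,
    [/\ T t s (P1 s v) = P1 t (T t s v),
        T t s (P2 s v) = P2 t (T t s v) &
        T t s (P3 s v) = P3 t (T t s v)])
  (hD : 0 < D) (hlambda : 0 < lambda) (hd : 0 <= d)
  (hP1_bound : forall t s, 0 <= s -> s <= t ->
    (opnorm (T t s \o P1 s)
      <= (D * (mu t / mu s) `^ (- lambda) * nu s `^ d)%:E)%E)
  (hP2_bound : forall t s, 0 <= t -> t <= s ->
    (opnorm (T t s \o P2 s)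
      <= (D * (mu s / mu t) `^ (- lambda) * nu s `^ d)%:E)%E)
  (hc : 0 <= c)
  (hf_lip : forall t, 0 <= t -> forall x y : X,
    `|f t x - f t y| <= c * dmu t / (mu t * nu t `^ d) * `|x - y|)
  (hP3_zero : forall t, 0 <= t -> forall v, P3 t v = 0)
  (hsmall : c * (2 * D + 1) + 2 * c * D * lambda^-1 < 1) :
  exists C : R, 0 < C /\
    forall (delta : R) (y dy : R -> X),
      0 < delta ->
      (forall t, 0 <= t -> has_deriv y t (dy t)) ->
      (forall t, 0 <= t ->
        `|dy t - A t (y t) - f t (y t)|
          <= delta * dmu t / (mu t * nu t `^ d)) ->
      exists x : R -> X,
        is_solution (fun t => A t : X -> X) f x /\
        (ereal_sup [set `|x t - y t|%:E | t in nonneg]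
          <= (C * delta)%:E)%E.
Proof.
have hP_sum0 v : P1 0 v + P2 0 v = v.
  by rewrite -[RHS](hP_sum 0 (lexx _)) hP3_zero ?addr0.
have hP1_inv t s : 0 <= t -> 0 <= s ->
    forall v, T t s (P1 s v) = P1 t (T t s v).
  by move=> t0 s0 v; have [] := hP_inv t s t0 s0 v.
have hP2_inv t s : 0 <= t -> 0 <= s ->
    forall v, T t s (P2 s v) = P2 t (T t s v).
  by move=> t0 s0 v; have [] := hP_inv t s t0 s0 v.
have adm := admissibility A T mu dmu nu P1 P2 D lambda d hA_bounded
  hA_continuous hT hmu_increasing hmu_deriv hmu0 hmu_lim hnu
  (proj1 (hP1 0 (lexx _))) (proj1 (hP2 0 (lexx _))) hP_sum0 hP1_inv hP2_inv
  hD hlambda hP1_bound hP2_bound.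
have wt_ge0 := weight_ge0 mu dmu nu d hmu_increasing hmu_deriv hmu0.
pose wt t := dmu t / (mu t * nu t `^ d).
(* [kappa] is the constant of [admissibility], and [rho] the factor by which one iteration shrinks
   the residual constant. *)
pose kappa := 2 * D / lambda; pose rho := c * kappa.
have kappa_gt0 : 0 < kappa by rewrite divr_gt0 ?mulr_gt0.
have rho_ge0 : 0 <= rho by rewrite mulr_ge0 // ltW.
have rho_lt1 : rho < 1.
  have -> : rho = 2 * c * D * lambda^-1 by rewrite /rho /kappa; ring.
  (* The other summand [c * (2 * D + 1)] of [hsmall] is nonnegative. *)
  by apply: le_lt_trans hsmall; rewrite lerDr mulr_ge0 //; lra.
have rho1 : 0 < 1 - rho by lra.
(* This is the sum of the step sizes [kappa * delta * rho ^+ n], divided by [delta]. *)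
exists (kappa / (1 - rho)); split; first by rewrite divr_gt0.
move=> delta y dy delta0 yd yf.
pose Q K x := exists dx, (forall t, 0 <= t -> has_deriv x t (dx t)) /\
  forall t, 0 <= t -> `|dx t - A t (x t) - f t (x t)| <= K * wt t.
have Qcont K x : Q K x -> cont_on_nonneg x.
  by move=> [dx [xd _]]; exact: has_deriv_cont xd.
have fcont x : cont_on_nonneg x -> cont_on_nonneg (fun t => f t (x t)).
  exact: cont_on_nonneg_graph.
have f_lip t x1 x2 B : 0 <= t -> `|x1 - x2| <= B ->
    `|f t x1 - f t x2| <= c * B * wt t.
  move=> t0 xB; apply: le_trans (hf_lip t t0 x1 x2) _.
  rewrite -(mulrA c (dmu t)) -/(wt t) mulrAC ler_wpM2r ?wt_ge0 //.
  by rewrite ler_wpM2l.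
(* The new residual is [f t (x t) - f t (x' t)], at most [c * (kappa * K)] times the weight. The
   conditions sit under the existential so that choice yields a total map; where they fail, [x] is
   the default. *)
have step (p : R * (R -> X)) : exists x', 0 <= p.1 -> Q p.1 p.2 ->
    Q (rho * p.1) x' /\ forall t, 0 <= t -> `|x' t - p.2 t| <= kappa * p.1.
  case: p => K x /=; have [K0|K0] := leP 0 K; last by exists x.
  have [Qx|nQ] := pselect (Q K x); last by exists x.
  have [dx [xd xK]] := Qx.
  have [w wd wK] := adm _ x dx K (fcont x (Qcont K x Qx)) K0 xd xK.
  exists w => _ _; split=> //; exists (fun t => A t (w t) + f t (x t)).
  split=> // t t0; rewrite (addrC (A t (w t))) addrK.
  have -> : rho * K = c * (kappa * K) by rewrite /rho mulrA.
  by apply: f_lip => //; rewrite distrC; exact: wK.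
have [nxt nxtP] := choice step.
pose p n := iter n (fun q => (rho * q.1, nxt q)) (delta, y).
have p1E n : (p n).1 = delta * rho ^+ n.
  by elim: n => [|n IH] /=; rewrite ?mulr1// IH exprS mulrCA.
have p1_ge0 n : 0 <= (p n).1 by rewrite p1E mulr_ge0 ?exprn_ge0// ltW.
have pQ n : Q (p n).1 (p n).2.
  elim: n => [|n IH]; last by have [] := nxtP (p n) (p1_ge0 n) IH.
  by exists dy; split => // t t0; rewrite /wt mulrA; exact: yf.
pose xn n := (p n).2.
have xn_step n t : 0 <= t -> `|xn n.+1 t - xn n t| <= kappa * delta * rho ^+ n.
  move=> t0; have [_ /(_ t t0)] := nxtP (p n) (p1_ge0 n) (pQ n).
  by rewrite p1E mulrA.
have kd0 : 0 <= kappa * delta by rewrite mulr_ge0 // ltW.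
have [x xnx] := picard_limit xn _ rho kd0 rho_ge0 rho_lt1 xn_step.
set beta := kappa * delta / (1 - rho) in xnx.
have beta_ge0 : 0 <= beta by rewrite divr_ge0 // ltW.
have geo0 (a : R) : a * rho ^+ n @[n --> \oo] --> 0.
  by apply: cvg_geometric; rewrite ger0_norm.
have x_cont : cont_on_nonneg x.
  apply: (uniform_lim_cont_on_nonneg xn x _ (geo0 beta)) => // n.
  exact: Qcont (pQ n).
exists x; split; last first.
  apply: ge_ereal_sup => _ [t t0 <-]; rewrite lee_fin distrC.
  have := xnx 0%N t t0; rewrite expr0 mulr1 /xn /=.
  by rewrite /beta [kappa * delta / _]mulrAC.
(* The limit [x] solves the equation because [w n] solves the linear equation
   forced by [f t (x t)], tends to [x], and differs from [w 0] by [T t 0]. *)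
have wn_ex n : exists w, (forall t, 0 <= t ->
    has_deriv w t (A t (w t) + f t (x t))) /\ forall t, 0 <= t ->
    `|w t - xn n t| <= kappa * (delta + c * beta) * rho ^+ n.
  have [dx [xd xK]] := pQ n.
  (* Relative to the forcing [f t (x t)], the residual of [xn n] gains the Lipschitz term
     [c * beta * rho ^+ n]. *)
  have K0 : 0 <= (delta + c * beta) * rho ^+ n.
    by rewrite mulr_ge0 ?exprn_ge0// addr_ge0 ?(ltW delta0)// mulr_ge0.
  have [|w wd wK] := adm _ (xn n) dx _ (fcont x x_cont) K0 xd.
    move=> t t0; rewrite -(subrKA (f t (xn n t))).
    apply: le_trans (ler_normD _ _) _.
    apply: le_trans (lerD (xK t t0) (f_lip _ _ _ _ t0 (xnx n t t0))) _.
    by rewrite p1E -/(wt t) -mulrDl mulrA -mulrDl.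
  by exists w; split => // t t0; rewrite -mulrA; exact: wK.
have [w wP] := choice wn_ex.
(* With this [v], the map [w 0%N t + T t 0 v] solves the same forced linear equation and starts at
   [x 0]. *)
pose v := x 0 - w 0%N 0.
have T0 t : 0 <= t -> linear (T t 0).
  by move=> t0; apply: (evolution_linear A T).
have xE t : 0 <= t -> w 0%N t + T t 0 v = x t.
  move=> t0.
  have [M M0 HM] := evolution_bounded A T hA_bounded hA_continuous hT t t0.
  pose gamma := kappa * (delta + c * beta) + beta.
  have wx n s : 0 <= s -> `|w n s - x s| <= gamma * rho ^+ n.
    move=> s0; rewrite -(subrKA (xn n s)); apply: le_trans (ler_normD _ _) _.
    by rewrite mulrDl lerD ?xnx//; have [_] := wP n; exact.
  apply/eqP; rewrite -subr_eq0; apply/eqP.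
  apply: (norm_le_cvg0_eq0 _ _ (geo0 ((M + 1) * gamma))) => n.
  (* All [w n] share the forcing [f s (x s)], so their differences solve the homogeneous
     equation. *)
  have wnE : T t 0 (w n 0 - w 0%N 0) = w n t - w 0%N t.
    apply: (evolution_unique A T hA_bounded hA_continuous hT
      (fun s => w n s - w 0%N s)) => // s s0.
    have [H _] := wP n; have [H0 _] := wP 0%N.
    have -> : A s (w n s - w 0%N s) = (A s (w n s) + f s (x s)) -
        (A s (w 0%N s) + f s (x s)).
      by rewrite linearB opprD addrACA subrr addr0.
    by apply: has_derivB; [exact: H|exact: H0].
  (* Rearranged through [w n], the discrepancy, which does not depend on [n], is at most
     [(M + 1) * gamma * rho ^+ n], hence zero. *)
  have -> : w 0%N t + T t 0 v - x t = (w n t - x t) - T t 0 (w n 0 - x 0).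
    have -> : w n 0 - x 0 = (w n 0 - w 0%N 0) - v by rewrite /v opprB subrKA.
    rewrite (linear_subE (T0 t t0) (w n 0 - w 0%N 0)) wnE.
    rewrite (opprB (w n t - w 0%N t)) (opprB (w n t)) [RHS]addrCA.
    by rewrite [X in _ = _ + X]addrC subrKA [RHS]addrA (addrC (T t 0 v)).
  apply: le_trans (ler_normB _ _) _.
  have := HM t 0 (w n 0 - x 0) t0 (lexx _) (lexx _) t0.
  have := wx n t t0; have := ler_wpM2l M0 (wx n 0 (lexx _)).
  lra.
(* The forcing is evaluated along [x] itself, so the forced linear equation, once [x] satisfies it,
   is the nonlinear one. *)
move=> t t0; apply: (has_deriv_eq _ _ _ _ xE t0).
have -> : A t (x t) + f t (x t) =
    (A t (w 0%N t) + f t (x t)) + (A t (T t 0 v) + T t 0 0).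
  by rewrite -(xE t t0) linearD (linear_0E (T0 t t0)) addr0 addrAC.
apply: has_derivD; first by have [H _] := wP 0%N; exact: H.
rewrite (linear_0E (T0 t t0)) addr0.
by apply: (evolution_deriv A T).
Qed.
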